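(* Let $d\in\mathbb N$, $m\in\mathbb N$, $U\subseteq\mathcal P([d])$, and $J_{\mathfrak u}\subseteq\mathfrak u$ for each $\mathfrak u\in U$. Let $C_{\mathfrak u,j}>0$ and $s_{\mathfrak u,j}>0$ be given for $\mathfrak u\in U$, $j\in J_{\mathfrak u}$, and let fixed real numbers $m_{\mathfrak u,j}>1$ be given for $\mathfrak u\in U$, $j\in\mathfrak u\setminus J_{\mathfrak u}$. Consider the optimization problem over the real variables $m_{\mathfrak u,j}>1$, $\mathfrak u\in U$, $j\in J_{\mathfrak u}$: $$\min_{m_{\mathfrak u,j}}\ \sum_{\mathfrak u\in U}\max_{j\in J_{\mathfrak u}}C_{\mathfrak u,j}(m_{\mathfrak u,j}-1)^{-2s_{\mathfrak u,j}}\qquad\text{subject to}\qquad\sum_{\mathfrak u\in U}\prod_{j\in\mathfrak u}(m_{\mathfrak u,j}-1)=m-1 .$$ Put $$A_{\mathfrak u}:=\frac12\sum_{j\in J_{\mathfrak u}}\frac1{s_{\mathfrak u,j}}\qquad\text{and}\qquad B_{\mathfrak u}:=\prod_{j\in J_{\mathfrak u}}C_{\mathfrak u,j}^{\frac1{2s_{\mathfrak u,j}}}\prod_{j\in\mathfrak u\setminus J_{\mathfrak u}}(m_{\mathfrak u,j}-1).$$ Let $\lambda>0$ satisfy the equation (whose left-hand side is monotone in $\lambda$) $$\sum_{\mathfrak u\in U}B_{\mathfrak u}^{\frac1{1+A_{\mathfrak u}}}(\lambda A_{\mathfrak u})^{-\frac{A_{\mathfrak u}}{1+A_{\mathfrak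 u}}}=m-1 .$$ Then the solution of the optimization problem is given by $$m_{\mathfrak u,j}=\left(\frac{C_{\mathfrak u,j}}{(\lambda B_{\mathfrak u}A_{\mathfrak u})^{\frac1{1+A_{\mathfrak u}}}}\right)^{\frac1{2s_{\mathfrak u,j}}}+1\qquad\text{for }\mathfrak u\in U,\ j\in J_{\mathfrak u}.$$
   Context: $[d]=\{1,\dots,d\}$ and $\mathcal P([d])$ is its power set. Interpretation: $m$ is a frequency budget, $U$ the set of active ANOVA terms, $J_{\mathfrak u}$ the set of dimensions of the term $\mathfrak u$ for which smoothness parameters are available, and $m_{\mathfrak u,j}$ bandwidths, treated here as real numbers. Conventions: an empty product equals $1$, a maximum over the empty set equals $0$, and if $A_{\mathfrak u}=0$ (i.e. $J_{\mathfrak u}=\emptyset$) then $(\lambda A_{\mathfrak u})^{-A_{\mathfrak u}/(1+A_{\mathfrak u})}$ is read as $1$. *)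

(* Defs.v *)
From mathcomp Require Import all_boot all_order all_algebra.
From mathcomp Require Import reals exp.

Set Implicit Arguments.
Unset Strict Implicit.
Unset Printing Implicit Defensive.

Import Order.TTheory GRing.Theory Num.Theory.
Local Open Scope ring_scope.

(* The index set [d] is 'I_d.  All families are total functions of the term u
   and the dimension j; only their values at u \in U and j \in J u
   (respectively j \in u :\: J u for the fixed bandwidths b) are relevant. *)

Section BandwidthOptimization.
Context {R : realType} {d : nat}.
Implicit Types (U : {set {set 'I_d}}) (J : {set 'I_d} -> {set 'I_d})
  (C s b x : {set 'I_d} -> 'I_d -> R) (u : {set 'I_d}) (j : 'I_d).

(* m_{u,j}: the variable x where smoothness is available, the given constant b
   elsewhere. *)
Definition bandwidth J b x u j : R := if j \in J u then x u j else b u j.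

(* The terms of the maximum are positive whenever C u j > 0 and x u j > 1, so
   the default value 0 only matters for J u = set0. *)
Definition objective U J C s x : R :=
  \sum_(u in U)
    \big[Num.max/0]_(j in J u) (C u j * (x u j - 1) `^ (- (2 * s u j))).

Definition feasible U J b (m : nat) x : Prop :=
  (forall u j, u \in U -> j \in J u -> 1 < x u j) /\
  \sum_(u in U) \prod_(j in u) (bandwidth J b x u j - 1) = m%:R - 1.

Definition minimizer U J C s b (m : nat) x : Prop :=
  feasible U J b m x /\
  forall y, feasible U J b m y -> objective U J C s x <= objective U J C s y.

Definition A_ J s u : R := 1 / 2 * \sum_(j in J u) 1 / s u j.

Definition B_ J C s b u : R :=
  (\prod_(j in J u) C u j `^ (1 / (2 * s u j))) *
  (\prod_(j in u :\: J u) (b u j - 1)).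

(* If A_ J s u = 0, the second factor is 0 `^ 0 = 1 (powRr0), which is the
   intended reading. *)
Definition budget U J C s b (lambda : R) : R :=
  \sum_(u in U)
    B_ J C s b u `^ (1 / (1 + A_ J s u)) *
    (lambda * A_ J s u) `^ (- (A_ J s u / (1 + A_ J s u))).

Definition optimal_bandwidth J C s b (lambda : R) u j : R :=
  (C u j / (lambda * B_ J C s b u * A_ J s u) `^ (1 / (1 + A_ J s u)))
    `^ (1 / (2 * s u j)) + 1.

End BandwidthOptimization.

(* Main.v *)
(* Lagrangian duality with multiplier lambda.  If the maximum of a term is M,
   then each gap m_{u,j} - 1 is at least the gap (C_{u,j}/M)^{1/(2 s_{u,j})} at
   level M, so the term costs at least B_u M^{-A_u}; moreover
   M + lambda B_u M^{-A_u} is minimal exactly at M = (lambda B_u A_u)^{1/(1+A_u)}.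
   In logarithmic coordinates both facts reduce to 1 + t <= exp t with equality
   only at t = 0.  Summing over U, feasibility fixes the total cost, and the
   equality case gives uniqueness. *)
Require Import Defs.
From mathcomp Require Import all_boot all_order all_algebra.
From mathcomp Require Import reals exp.
From mathcomp Require Import sequences ring lra.

Set Implicit Arguments.
Unset Strict Implicit.
Unset Printing Implicit Defensive.

Import Order.TTheory GRing.Theory Num.Theory.
Local Open Scope ring_scope.

Lemma expR_leif (R : realType) (t : R) : 1 + t <= expR t ?= iff (t == 0).
Proof.
apply/leifP; case: (eqVneq t 0) => [->|/expR_gt1Dx //].
by rewrite expR0 addr0.
Qed.

Lemma leif_pMl (R : realFieldType) (k x y : R) (P : bool) :
  0 < k -> x <= y ?= iff P -> k * x <= k * y ?= iff P.
Proof. by move=> k_gt0; rewrite (mono_leif (ler_pM2l k_gt0)). Qed.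

(** * Levels, gaps and the Lagrangian inequality for one abstract term *)

Section OneTerm.
Context {R : realType} {I : finType}.
Implicit Types (S : {set I}) (c s p : I -> R) (M K : R).

(** The gap [p] solving [c j * p^(-2 s j) = M], that is, the one whose error is exactly [M]. *)
Definition level_gap c s M (j : I) : R := (c j / M) `^ (1 / (2 * s j)).

Lemma level_gap_gt0 c s M j : 0 < M -> 0 < c j -> 0 < level_gap c s M j.
Proof. by move=> M_gt0 c_gt0; rewrite powR_gt0// divr_gt0. Qed.

Lemma level_gapK c s M j : 0 < M -> 0 < c j -> 0 < s j ->
  c j * level_gap c s M j `^ (- (2 * s j)) = M.
Proof.
move=> M_gt0 c_gt0 s_gt0; rewrite /level_gap -powRrM.
have -> : 1 / (2 * s j) * - (2 * s j) = - 1 by field; rewrite gt_eqF.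
by rewrite powR_inv1 ?divr_ge0 ?ltW//; field; rewrite !gt_eqF.
Qed.

(** Each gap splits into a power of [c j] and a power of [M], and the exponents of [M] add up. This
    is the source of the form [B_u M^(-A_u)] of the cost. *)
Lemma prod_level_gap S c s M : 0 < M ->
    (forall j, j \in S -> 0 < c j) -> (forall j, j \in S -> 0 < s j) ->
  \prod_(j in S) level_gap c s M j =
  \prod_(j in S) c j `^ (1 / (2 * s j)) * M `^ (- (1 / 2 * \sum_(j in S) 1 / s j)).
Proof.
move=> M_gt0 c_gt0 s_gt0.
have -> : M `^ (- (1 / 2 * \sum_(j in S) 1 / s j)) =
    \prod_(j in S) M `^ (- (1 / (2 * s j))).
  (* Since [M] is nonzero, [powR] unfolds to the exponential of a multiple of [ln M], which turns
     the sum of exponents into a product. *)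
  rewrite mulr_sumr -sumrN /powR gt_eqF// mulr_suml expR_sum.
  by apply: eq_bigr => j Sj; congr (expR (- _ * _)); field; rewrite gt_eqF ?s_gt0.
rewrite -big_split; apply: eq_bigr => j Sj /=.
rewrite /level_gap powRM ?invr_ge0 ?ltW ?c_gt0//.
by rewrite -[M^-1]powR_inv1 ?ltW// -powRrM mulN1r.
Qed.

Definition max_error S c s p : R :=
  \big[Num.max/0]_(j in S) (c j * p j `^ (- (2 * s j))).

(** At these gaps all errors equal [M]; a witness in [S] is essential because the empty maximum is
    0. *)
Lemma max_level_gap S c s M : S != set0 -> 0 < M ->
    (forall j, j \in S -> 0 < c j) -> (forall j, j \in S -> 0 < s j) ->
  max_error S c s (level_gap c s M) = M.
Proof.
move=> /set0Pn[i Si] M_gt0 c_gt0 s_gt0; apply/le_anti/andP; split.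
  by apply: bigmax_le => [|j Sj]; [exact: ltW|rewrite level_gapK ?c_gt0 ?s_gt0].
by apply: (bigmax_sup i) => //; rewrite level_gapK ?c_gt0 ?s_gt0.
Qed.

(* With [v] the logarithm of the ratio of the maxima and [w j] that of the
   gaps, the difference of the two sides is
   M (exp v - 1 - v) + K (exp (sum w) - 1 - sum w) + (M v + K sum w), and by the
   choice of [K] the last part is K times the sum of the [v / (2 s_j) + w j],
   which are nonnegative because the [j]-th error is at most the maximum. *)
Lemma lagrangian_leif S c s p M K : S != set0 -> 0 < M ->
    (forall j, j \in S -> 0 < c j) -> (forall j, j \in S -> 0 < s j) ->
    (forall j, j \in S -> 0 < p j) ->
    M = K * (1 / 2 * \sum_(j in S) 1 / s j) ->
  M + K <= max_error S c s p + K * \prod_(j in S) (p j / level_gap c s M j)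
    ?= iff [forall (j | j \in S), p j == level_gap c s M j].
Proof.
move=> S_neq0 M_gt0 c_gt0 s_gt0 p_gt0 MK.
have q_gt0 j : j \in S -> 0 < level_gap c s M j.
  by move=> Sj; rewrite level_gap_gt0 ?c_gt0.
have r_gt0 j : j \in S -> 0 < p j / level_gap c s M j.
  by move=> Sj; rewrite divr_gt0 ?p_gt0 ?q_gt0.
(* The positive number [M] is [K] times a nonnegative factor, which forces the sign of [K]. *)
have K_gt0 : 0 < K.
  have a_ge0 : 0 <= 1 / 2 * \sum_(j in S) 1 / s j.
    apply: mulr_ge0; first by rewrite divr_ge0.
    by apply: sumr_ge0 => j Sj; rewrite divr_ge0 ?ltW ?s_gt0.
  rewrite ltNge; apply/negP => K_le0.
  by have := mulr_le0_ge0 K_le0 a_ge0; rewrite -MK leNgt M_gt0.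
have err_le j : j \in S -> c j * p j `^ (- (2 * s j)) <= max_error S c s p.
  by move=> Sj; apply: (bigmax_sup j).
have V_gt0 : 0 < max_error S c s p.
  have /set0Pn[i Si] := S_neq0.
  by apply: lt_le_trans (err_le i Si); rewrite mulr_gt0 ?c_gt0// powR_gt0 ?p_gt0.
set V := max_error S c s p in err_le V_gt0 *.
pose v := ln (V / M); pose w j := ln (p j / level_gap c s M j).
have VE : V = M * expR v by rewrite lnK ?posrE ?divr_gt0//; field; rewrite gt_eqF.
have wE j : j \in S -> p j / level_gap c s M j = expR (w j).
  by move=> Sj; rewrite lnK// posrE r_gt0.
have slack_ge0 j : j \in S -> 0 <= v / (2 * s j) + w j.
  move=> Sj; have s0 := s_gt0 _ Sj.
  suff : - (2 * s j) * w j <= v.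
    by move=> h; rewrite -lerBlDr sub0r ler_pdivlMr ?mulr_gt0//; lra.
  rewrite -ler_expR -(ler_pM2l M_gt0) -VE; apply: le_trans (err_le j Sj).
  have -> : p j = level_gap c s M j * expR (w j).
    by rewrite -wE//; field; rewrite gt_eqF ?q_gt0.
  rewrite powRM ?expR_ge0 ?(ltW (q_gt0 j Sj))// mulrA level_gapK ?c_gt0//.
  by rewrite -expRM [w j * _]mulrC.
have slackE : M * v + K * \sum_(j in S) w j =
    K * \sum_(j in S) (v / (2 * s j) + w j).
  rewrite big_split/= mulrDr; congr (_ + _).
  rewrite {1}MK -mulrA mulr_sumr mulr_suml; congr (K * _).
  by apply: eq_bigr => j Sj; field; rewrite gt_eqF ?s_gt0.
have prodE : \prod_(j in S) (p j / level_gap c s M j) = expR (\sum_(j in S) w j).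
  by rewrite expR_sum; apply: eq_bigr => j; apply: wE.
have leif1 := leifD (leif_pMl M_gt0 (expR_leif v))
  (leif_pMl K_gt0 (expR_leif (\sum_(j in S) w j))).
have leif2 : M + K <= M * (1 + v) + K * (1 + \sum_(j in S) w j) ?= iff
    [forall (j | j \in S), 0 == v / (2 * s j) + w j].
  have -> : M * (1 + v) + K * (1 + \sum_(j in S) w j) =
      (M * v + K * \sum_(j in S) w j) + (M + K) by ring.
  rewrite slackE -leifBLR subrr -[X in X <= _ ?= iff _](mulr0 K).
  apply: leif_pMl => //; apply: leif_0_sum => j Sj; exact/leif_eq/slack_ge0.
have := leif_trans leif2 leif1; rewrite -VE -prodE => leifT.
have [leT eqT] := leifT; split=> //; rewrite eqT; apply/idP/idP.
  (* Equality forces [v = 0]; the vanishing slack of [j] then gives [w j = 0], so the gap ratio is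
     1. *)
  case/andP=> /forall_inP slack0 /andP[/eqP v0 _]; apply/forall_inP => j Sj.
  have /eqP := slack0 j Sj; rewrite v0 mul0r add0r => w0.
  have := wE j Sj; rewrite -w0 expR0 => /(congr1 ( *%R^~ (level_gap c s M j))).
  by rewrite mul1r divfK ?(gt_eqF (q_gt0 j Sj))// => ->.
(* Conversely, [eqT] trades the equality conditions for equality of the two values, which holds
   because the maximum is [M] and every ratio is 1. *)
move=> /forall_inP pq; rewrite -eqT.
have -> : V = M.
  rewrite -[RHS](max_level_gap S_neq0 M_gt0 c_gt0 s_gt0) /V /max_error.
  by apply: eq_bigr => j Sj; rewrite (eqP (pq j Sj)).
rewrite big1 ?mulr1// => j Sj.
by rewrite (eqP (pq j Sj)) divff// gt_eqF ?q_gt0.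
Qed.

End OneTerm.

(** * Error, cost and Lagrangian of one ANOVA term *)

Section Bandwidths.
Context {R : realType} {d : nat}.
Implicit Types (U : {set {set 'I_d}}) (J : {set 'I_d} -> {set 'I_d})
  (C s b x : {set 'I_d} -> 'I_d -> R) (u : {set 'I_d}) (l : R).

Definition cost J b x u : R := \prod_(j in u) (bandwidth J b x u j - 1).

Definition term_error J C s x u : R :=
  max_error (J u) (C u) (s u) (fun j => x u j - 1).

Definition optimal_error J C s b l u : R :=
  (l * B_ J C s b u * A_ J s u) `^ (1 / (1 + A_ J s u)).

Lemma costE J b x u : J u \subset u ->
  cost J b x u =
  \prod_(j in J u) (x u j - 1) * \prod_(j in u :\: J u) (b u j - 1).
Proof.
move=> Ju; rewrite /cost (big_setID (J u))/= (setIidPr Ju).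
congr (_ * _); apply: eq_bigr => j; rewrite /bandwidth; first by move=> ->.
by case/setDP=> _ /negPf ->.
Qed.

Lemma eq_cost J b x y u : (forall j, j \in J u -> x u j = y u j) ->
  cost J b x u = cost J b y u.
Proof.
move=> xy; apply: eq_bigr => j _; rewrite /bandwidth.
by case: ifP => // /xy ->.
Qed.

Lemma eq_term_error J C s x y u : (forall j, j \in J u -> x u j = y u j) ->
  term_error J C s x u = term_error J C s y u.
Proof. by move=> xy; apply: eq_bigr => j /xy ->. Qed.

Lemma A_ge0 J s u : (forall j, j \in J u -> 0 < s u j) -> 0 <= A_ J s u.
Proof.
move=> s_gt0; apply: mulr_ge0; first by rewrite divr_ge0.
by apply: sumr_ge0 => j Jj; rewrite divr_ge0 ?ltW ?s_gt0.
Qed.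

Lemma A_gt0 J s u : J u != set0 -> (forall j, j \in J u -> 0 < s u j) ->
  0 < A_ J s u.
Proof.
move=> /set0Pn[i Ji] s_gt0; apply: mulr_gt0; first by rewrite divr_gt0.
rewrite (bigD1 i)//= ltr_pwDl ?divr_gt0 ?s_gt0//.
by apply: sumr_ge0 => j /andP[Jj _]; rewrite divr_ge0 ?ltW ?s_gt0.
Qed.

Lemma A_set0 J s u : J u = set0 -> A_ J s u = 0.
Proof. by move=> Ju0; rewrite /A_ Ju0 big_set0 mulr0. Qed.

(** The powers of [B] combine through [1 - A/(1+A) = 1/(1+A)]. This identifies the cost at the
    optimal level with a summand of [budget]. *)
Lemma budget_term_level (B A l : R) : 0 < B -> 0 < A -> 0 < l ->
  B * ((l * B * A) `^ (1 / (1 + A))) `^ (- A) =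
  B `^ (1 / (1 + A)) * (l * A) `^ (- (A / (1 + A))).
Proof.
move=> B_gt0 A_gt0 l_gt0; have A1 : 1 + A != 0 by rewrite gt_eqF// addr_gt0.
rewrite -powRrM; have -> : 1 / (1 + A) * - A = - (A / (1 + A)) by field.
have -> : l * B * A = B * (l * A) by ring.
rewrite powRM ?mulr_ge0 ?ltW// mulrA; congr (_ * _).
rewrite -{1}[B]powRr1 ?ltW// -powRD ?(gt_eqF B_gt0) ?implybT//.
by congr powR; field.
Qed.

(** First-order condition for [M + l B M^(-A)], namely [M^(1+A) = l B A]. It supplies the relation
    between [M] and [K] that [lagrangian_leif] requires. *)
Lemma level_multiplier (B A l : R) : 0 < B -> 0 < A -> 0 < l ->
  (l * B * A) `^ (1 / (1 + A)) =
  l * (B * ((l * B * A) `^ (1 / (1 + A))) `^ (- A)) * A.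
Proof.
move=> B_gt0 A_gt0 l_gt0; have A1 : 1 + A != 0 by rewrite gt_eqF// addr_gt0.
set D := l * B * A; have D_gt0 : 0 < D by rewrite !mulr_gt0.
have -> : l * (B * D `^ (1 / (1 + A)) `^ (- A)) * A =
  D * D `^ (1 / (1 + A)) `^ (- A) by rewrite /D; ring.
rewrite -{2}[D]powRr1 ?ltW// -powRrM -powRD ?(gt_eqF D_gt0) ?implybT//.
by congr powR; field.
Qed.

Context {J : {set 'I_d} -> {set 'I_d}} {C s b : {set 'I_d} -> 'I_d -> R}
  {u : {set 'I_d}} {l : R}.
Hypotheses (J_sub : J u \subset u)
  (C_gt0 : forall j, j \in J u -> 0 < C u j)
  (s_gt0 : forall j, j \in J u -> 0 < s u j)
  (b_gt1 : forall j, j \in u :\: J u -> 1 < b u j) (l_gt0 : 0 < l).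

Let opt := optimal_bandwidth J C s b l.

Lemma B_gt0 : 0 < B_ J C s b u.
Proof.
apply: mulr_gt0; apply: prodr_gt0 => j uj; first by rewrite powR_gt0 ?C_gt0.
by rewrite subr_gt0 b_gt1.
Qed.

Lemma optimal_error_gt0 : J u != set0 -> 0 < optimal_error J C s b l u.
Proof.
by move=> Ju; apply/powR_gt0/mulr_gt0; [exact: mulr_gt0 l_gt0 B_gt0|exact: A_gt0].
Qed.

Lemma optimal_gapE j :
  opt u j - 1 = level_gap (C u) (s u) (optimal_error J C s b l u) j.
Proof. exact: addrK. Qed.

Lemma optimal_bandwidth_gt1 j : j \in J u -> 1 < opt u j.
Proof.
move=> Jj; rewrite -subr_gt0 optimal_gapE level_gap_gt0 ?C_gt0//.
by apply: optimal_error_gt0; apply/set0Pn; exists j.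
Qed.

Lemma optimal_costE : J u != set0 ->
  cost J b opt u =
  B_ J C s b u * optimal_error J C s b l u `^ (- A_ J s u).
Proof.
move=> Ju; rewrite costE//.
rewrite (eq_bigr _ (fun j _ => optimal_gapE j)) prod_level_gap//.
  by rewrite /B_ /A_ mulrAC.
exact: optimal_error_gt0.
Qed.

Lemma optimal_cost :
  cost J b opt u =
  B_ J C s b u `^ (1 / (1 + A_ J s u)) *
  (l * A_ J s u) `^ (- (A_ J s u / (1 + A_ J s u))).
Proof.
have [Ju0|Ju] := eqVneq (J u) set0; last first.
  by rewrite optimal_costE// budget_term_level ?B_gt0 ?(A_gt0 Ju s_gt0).
(* For empty [J u] the second factor has exponent 0, hence equals 1, and [B_] is the product of the
   fixed gaps. *)
rewrite costE// A_set0// mul0r oppr0 powRr0 addr0 divr1 powRr1 ?ltW ?B_gt0//.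
by rewrite /B_ Ju0 !big_set0 mulr1.
Qed.

Lemma term_lagrangian_leif x : (forall j, j \in J u -> 1 < x u j) ->
  term_error J C s opt u + l * cost J b opt u <=
  term_error J C s x u + l * cost J b x u
    ?= iff [forall (j | j \in J u), x u j == opt u j].
Proof.
(* Without free bandwidths both sides coincide and the equality condition holds vacuously. *)
move=> x_gt1; have [Ju0|Ju] := eqVneq (J u) set0.
  rewrite (@eq_term_error _ _ _ _ x) => [|j]; last by rewrite Ju0 inE.
  rewrite (@eq_cost _ _ _ x) => [|j]; last by rewrite Ju0 inE.
  by apply/leif_refl/forall_inP => j; rewrite Ju0 inE.
set M := optimal_error J C s b l u.
have M_gt0 : 0 < M := optimal_error_gt0 Ju.
have ME : M = l * cost J b opt u * A_ J s u.
  by rewrite optimal_costE//; apply: level_multiplier; rewrite ?B_gt0 ?(A_gt0 Ju s_gt0).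
have errE : term_error J C s opt u = M.
  rewrite -[RHS](max_level_gap Ju M_gt0 C_gt0 s_gt0).
  by apply: eq_bigr => j _; rewrite optimal_gapE.
(* The fixed factors cancel in the ratio of costs, so [K] is [l] times the optimal cost. *)
have costxE : l * cost J b x u = l * cost J b opt u *
    \prod_(j in J u) ((x u j - 1) / level_gap (C u) (s u) M j).
  rewrite prodf_div -(eq_bigr _ (fun j _ => optimal_gapE j)) !costE//.
  field; apply/prodf_neq0 => j Jj.
  by rewrite gt_eqF// subr_gt0 optimal_bandwidth_gt1.
have x_gap j : j \in J u -> 0 < x u j - 1 by move=> Jj; rewrite subr_gt0 x_gt1.
rewrite errE costxE.
have -> : [forall (j | j \in J u), x u j == opt u j] =
    [forall (j | j \in J u), x u j - 1 == level_gap (C u) (s u) M j].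
  by apply: eq_forallb => j; rewrite -optimal_gapE (inj_eq (addIr _)).
exact: lagrangian_leif.
Qed.

End Bandwidths.

(** * Monotonicity of the budget and summation over the terms *)

Theorem lemma4p1 (R : realType) (d m : nat)
    (U : {set {set 'I_d}}) (J : {set 'I_d} -> {set 'I_d})
    (C s b : {set 'I_d} -> 'I_d -> R)
    (J_sub : forall u, u \in U -> J u \subset u)
    (C_gt0 : forall u j, u \in U -> j \in J u -> 0 < C u j)
    (s_gt0 : forall u j, u \in U -> j \in J u -> 0 < s u j)
    (b_gt1 : forall u j, u \in U -> j \in u :\: J u -> 1 < b u j) :
  (forall l1 l2 : R, 0 < l1 -> l1 <= l2 ->
     budget U J C s b l2 <= budget U J C s b l1) /\
  (forall lambda : R, 0 < lambda ->
     budget U J C s b lambda = m%:R - 1 ->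
     forall x : {set 'I_d} -> 'I_d -> R,
       minimizer U J C s b m x <->
       (forall u j, u \in U -> j \in J u ->
          x u j = optimal_bandwidth J C s b lambda u j)).
Proof.
split=> [l1 l2 l1_gt0 l12|l l_gt0 budgetE x].
  apply: ler_sum => u Uu; rewrite ler_wpM2l ?powR_ge0//.
  have A0 : 0 <= A_ J s u by apply: A_ge0 => j; apply: s_gt0.
  (* If [A_] vanishes, the multiplier drops out of the summand; otherwise the summand carries a
     negative power of it. *)
  have [A_eq0|A_neq0] := eqVneq (A_ J s u) 0; first by rewrite A_eq0 !mulr0.
  have Apos : 0 < A_ J s u by rewrite lt_def A_neq0.
  have l2_gt0 := lt_le_trans l1_gt0 l12.
  rewrite !powRN lef_pV2 ?posrE ?powR_gt0 ?(mulr_gt0 _ Apos)//.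
  apply: ge0_ler_powR; rewrite ?nnegrE.
  - by rewrite divr_ge0// addr_ge0.
  - by rewrite mulr_ge0// ltW.
  - by rewrite mulr_ge0// ltW.
  - by rewrite ler_wpM2r.
pose opt := optimal_bandwidth J C s b l.
have opt_feasible : feasible U J b m opt.
  split=> [u j Uu Jj|].
    exact: (optimal_bandwidth_gt1 (C_gt0 u ^~ Uu) (s_gt0 u ^~ Uu) (b_gt1 u ^~ Uu)).
  rewrite -budgetE; apply: eq_bigr => u Uu.
  exact: (optimal_cost (J_sub u Uu) (C_gt0 u ^~ Uu) (s_gt0 u ^~ Uu) (b_gt1 u ^~ Uu)).
(* The constraint fixes the total cost, so on feasible points the objective and the Lagrangian
   differ by a constant. *)
have lagrangianE y : feasible U J b m y -> objective U J C s y =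
    \sum_(u in U) (term_error J C s y u + l * cost J b y u) - l * (m%:R - 1).
  by case=> _ <-; rewrite big_split/= -mulr_sumr addrK.
have opt_leif y : feasible U J b m y -> objective U J C s opt <=
    objective U J C s y ?= iff
    [forall (u | u \in U), [forall (j | j \in J u), y u j == opt u j]].
  move=> y_feas; rewrite !lagrangianE// leifBLR subrK; apply: leif_sum => u Uu.
  by apply: (term_lagrangian_leif (J_sub u Uu) (C_gt0 u ^~ Uu) (s_gt0 u ^~ Uu)
    (b_gt1 u ^~ Uu)) => // j; apply: y_feas.1.
split=> [[x_feas x_min] u j Uu Jj|x_opt].
  (* Minimality of [x] against [opt] gives the reverse inequality, hence the equality case. *)
  have := ge_leif (opt_leif x x_feas); rewrite x_min// => /esym.
  by move=> /forall_inP/(_ u Uu)/forall_inP/(_ j Jj)/eqP.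
(* [x] agrees with [opt] only at the relevant indices, so feasibility and objective are transferred
   term by term. *)
have x_feas : feasible U J b m x.
  split=> [u j Uu Jj|]; first by rewrite x_opt//; exact: opt_feasible.1.
  rewrite -opt_feasible.2; apply: eq_bigr => u Uu; apply: eq_cost => j Jj.
  exact: x_opt.
split=> // y y_feas; have -> : objective U J C s x = objective U J C s opt.
  by apply: eq_bigr => u Uu; apply: eq_term_error => j Jj; apply: x_opt.
exact: (opt_leif y y_feas).1.
Qed.
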